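(* Let $\mathbb{K}$ be any field. If $\mathcal{M}$ is a matroid on $[n]=\{1,\dots,n\}$ of corank at most two, then $T^2(\mathcal{M})=0$.
   Context: A matroid on $[n]$ is regarded as the simplicial complex $\mathcal{M}\subseteq 2^{[n]}$ of its independent sets: a nonempty family closed under taking subsets such that whenever $I,J\in\mathcal{M}$ with $\#J<\#I$ there is $v\in I\setminus J$ with $J\cup\{v\}\in\mathcal{M}$. If $\mathcal{M}$ has rank $r$ (the common cardinality of its maximal elements), its corank is $n-r$. Loops are allowed. For a simplicial complex $\Delta$ on $[n]$, $T^2(\Delta)$ is the second cotangent cohomology module of the Stanley-Reisner ring $S/I_\Delta$, where $S=\mathbb{K}[x_1,\dots,x_n]$ and $I=I_\Delta=\langle\prod_{i\in F}x_i : F\subseteq[n],\ F\notin\Delta\rangle$. Explicitly: let $m$ be the number of minimal monomial generators of $I$, let $d:S^m\to S$ be the $S$-linear map sending the canonical basis to these generators, $\operatorname{Syz}(I)=\ker d$, and $\operatorname{Kosz}(I)\subseteq\operatorname{Syz}(I)$ the submodule generated by all $d(f)g-d(g)f$ with $f,g\in S^m$. The quotient $\operatorname{Syz}(I)/\operatorname{Kosz}(I)$ is an $S/I$-module, and $T^2(\Delta)$ is the cokernel of the induced (restriction) map $\operatorname{Hom}_S(S^m,S/I)\to\operatorname{Hom}_{S/I}(\operatorname{Syz}(I)/\operatorname{Kosz}(I),S/I)$. *)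

(* Defs.v *)
From HB Require Import structures.
From mathcomp Require Import all_boot all_order all_algebra.
From mathcomp Require Import boolp classical_sets functions.
From mathcomp Require Import mpoly.

Set Implicit Arguments.
Unset Strict Implicit.
Unset Printing Implicit Defensive.

Import GRing.Theory.
Local Open Scope ring_scope.
Local Open Scope quotient_scope.

(* The vertex set [n] = {1, ..., n} is represented by 'I_n. *)
Record complex (n : nat) := Complex {
  faces :> {set {set 'I_n}};
  complex_nonempty : faces != finset.set0;
  complex_down : forall I J : {set 'I_n}, I \in faces -> J \subset I -> J \in faces
}.

(* The faces of a matroid are its independent sets. *)
Definition matroid (n : nat) (M : complex n) : Prop :=
  forall I J : {set 'I_n}, I \in faces M -> J \in faces M -> (#|J| < #|I|)%N ->
  exists v : 'I_n, [/\ v \in I, v \notin J & v |: J \in faces M].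

(* The common cardinality of the maximal faces, see card_basis. *)
Definition rank (n : nat) (M : complex n) : nat := \max_(I in faces M) #|I|.

Definition corank (n : nat) (M : complex n) : nat := n - rank M.

Section ComplexFacts.
Context {n : nat}.
Implicit Types (M : complex n).

Lemma complex0 M : finset.set0 \in faces M.
Proof.
have /finset.set0Pn[I IM] := complex_nonempty M.
by apply: complex_down IM _; rewrite finset.sub0set.
Qed.

Lemma card_basis M (B : {set 'I_n}) :
  matroid M -> maxset (fun I => I \in faces M) B -> #|B| = rank M.
Proof.
move=> mM /maxsetP[BM Bmax]; apply/eqP; rewrite eqn_leq.
rewrite (leq_bigmax_cond (F := fun I : {set 'I_n} => #|I|)) //=.
apply/bigmax_leqP => I IM; rewrite leqNgt; apply/negP => ltBI.
have [v [vI vB vBM]] := mM _ _ IM BM ltBI.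
by move: vB; rewrite -(Bmax _ vBM (finset.subsetUr _ _)) finset.setU11.
Qed.

End ComplexFacts.

Section Span.
Context {R : pzRingType} {V : lmodType R}.

Definition spanned (G : V -> Prop) (x : V) : Prop :=
  exists (k : nat) (a : 'I_k -> R) (g : 'I_k -> V),
    (forall i, G (g i)) /\ x = \sum_(i < k) a i *: g i.

Lemma spanned_gen G x : G x -> spanned G x.
Proof.
by move=> Gx; exists 1, (fun=> 1), (fun=> x); rewrite big_ord1 scale1r.
Qed.

Lemma spanned0 G : spanned G 0.
Proof.
exists 0, (fun=> 0), (fun=> 0); split; last by rewrite big_ord0.
by case.
Qed.

Lemma spannedD G x y : spanned G x -> spanned G y -> spanned G (x + y).
Proof.
move=> [k [a [g [Gg ->]]]] [l [b [h [Gh ->]]]].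
exists (k + l)%N,
  (fun i => match fintype.split i with inl j => a j | inr j => b j end),
  (fun i => match fintype.split i with inl j => g j | inr j => h j end); split.
  by move=> i; case: (fintype.split i).
rewrite big_split_ord /=; congr (_ + _); apply: eq_bigr => i _.
  by rewrite (unsplitK (inl i)).
by rewrite (unsplitK (inr i)).
Qed.

Lemma spannedZ G c x : spanned G x -> spanned G (c *: x).
Proof.
move=> [k [a [g [Gg ->]]]]; exists k, (fun i => c * a i), g; split=> //.
by rewrite scaler_sumr; apply: eq_bigr => i _; rewrite scalerA.
Qed.

End Span.

Section Hom.
Context {R : comNzRingType} (U V : lmodType R).

Definition linear_pred : {pred U -> V} := fun f => `[< linear f >].

Fact linear_pred_submod : submod_closed linear_pred.
Proof.
split=> [|a f g /asboolP fL /asboolP gL]; apply/asboolP => b x y.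
  have z0 z : (0 : U -> V) z = 0 by [].
  by rewrite !z0 scaler0 addr0.
have E z : (a *: f + g) z = a *: f z + g z by [].
by rewrite !E fL gL !scalerDr !scalerA mulrC addrACA.
Qed.

HB.instance Definition _ :=
  GRing.isSubmodClosed.Build R (U -> V) linear_pred linear_pred_submod.

Record hom := MkHom { hom_fun :> U -> V; hom_funP : hom_fun \in linear_pred }.

HB.instance Definition _ := [isSub for hom_fun].
HB.instance Definition _ := [Choice of hom by <:].
HB.instance Definition _ := [SubChoice_isSubLmodule of hom by <:].

Definition mkHom (f : U -> V) (fL : linear f) : hom := MkHom (asboolT fL).

Fact hom_fun_linear (f : hom) : linear (hom_fun f).
Proof. exact/asboolP/hom_funP. Qed.

HB.instance Definition _ (f : hom) :=
  GRing.isLinear.Build R U V *:%R (hom_fun f) (hom_fun_linear f).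

Lemma homP (f g : hom) : hom_fun f =1 hom_fun g -> f = g.
Proof. by move=> fg; apply/val_inj/funext. Qed.

Lemma hom0E x : (0 : hom) x = 0. Proof. by []. Qed.
Lemma homDE (f g : hom) x : (f + g) x = f x + g x. Proof. by []. Qed.
Lemma homZE a (f : hom) x : (a *: f) x = a *: f x. Proof. by []. Qed.

End Hom.
Arguments hom {R} U V.

Section StanleyReisner.
Context (K : fieldType) {n : nat} (D : complex n).
Local Notation S := {mpoly K[n]}.

Definition xmon (F : {set 'I_n}) : S := \prod_(i in F) 'X_i.

Definition SR_ideal : {pred S} := fun p =>
  `[< @spanned S S^o (fun q => exists F, F \notin faces D /\ q = xmon F) p >].

Lemma xmonE F : xmon F = 'X_[[multinom (i \in F : nat) | i < n]].
Proof.
rewrite mpolyXE_id /xmon big_mkcond /=; apply: eq_bigr => i _; rewrite mnmE.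
by case: ifP.
Qed.

Lemma xmon_ideal F : F \notin faces D -> xmon F \in SR_ideal.
Proof. by move=> FD; apply/asboolP/spanned_gen; exists F. Qed.

Lemma SR_ideal_msupp p (m : 'X_{1..n}) : p \in SR_ideal -> m \in msupp p ->
  [set i | m i != 0%N]%SET \notin faces D.
Proof.
move=> /asboolP[k [a [g [Gg ->]]]] /msupp_sum_le /flatten_mapP[j _].
have [F [FD ->]] := Gg j; rewrite xmonE => mj.
apply: contra FD => mD; apply: (complex_down mD).
have := msuppM_le mj; move=> /allpairsP[[m1 m2] /= [_ + ->]].
rewrite msuppX inE => /eqP->; apply/fintype.subsetP => i iF.
by rewrite inE mnmDE mnmE iF addn1.
Qed.

Fact SR_ideal_idealr : idealr_closed SR_ideal.
Proof.
split.
- exact/asboolP/spanned0.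
- apply/negP => /(@SR_ideal_msupp _ 0%MM); rewrite msupp1 inE eqxx => /(_ isT).
  rewrite (_ : [set _ | _]%SET = finset.set0) ?complex0 //.
  by apply/finset.setP => i; rewrite !inE mnm0E.
- move=> a u v /asboolP uI /asboolP vI; apply/asboolP.
  by apply: spannedD vI; apply: (@spannedZ S S^o).
Qed.

HB.instance Definition _ := isIdealr.Build S SR_ideal SR_ideal_idealr.

Definition SR_ring := {ideal_quot SR_ideal}.

HB.instance Definition _ := GRing.ComNzRing.on SR_ring.

Definition SR_pi (p : S) : SR_ring := \pi_SR_ring p.

Lemma SR_piP p q : SR_pi p = SR_pi q <-> p - q \in SR_ideal.
Proof.
by rewrite (Quotient.idealrBE SR_ideal); split=> [E|/eqP//]; apply/eqP.
Qed.

Lemma SR_pi_ideal p : p \in SR_ideal -> SR_pi p = 0.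
Proof.
by move=> pI; rewrite -(rmorph0 \pi_SR_ring); apply/SR_piP; rewrite subr0.
Qed.

Lemma SR_reprK (a : SR_ring) : SR_pi (repr a) = a.
Proof. exact: reprK. Qed.

HB.instance Definition _ := GRing.RMorphism.copy SR_pi \pi_SR_ring.

(* S/I is also an S-module, by restriction of scalars along SR_pi. *)
Definition SR_scale (p : S) (a : SR_ring) : SR_ring := SR_pi p * a.

Fact SR_scaleA p q a : SR_scale p (SR_scale q a) = SR_scale (p * q) a.
Proof. by rewrite /SR_scale rmorphM mulrA. Qed.
Fact SR_scale1 : left_id 1 SR_scale.
Proof. by move=> a; rewrite /SR_scale rmorph1 mul1r. Qed.
Fact SR_scaleDr : right_distributive SR_scale +%R.
Proof. by move=> p a b; rewrite /SR_scale mulrDr. Qed.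
Fact SR_scaleDl a : {morph SR_scale^~ a : p q / p + q}.
Proof. by move=> p q; rewrite /SR_scale rmorphD mulrDl. Qed.

HB.instance Definition _ := GRing.Zmodule_isLmodule.Build S SR_ring
  SR_scaleA SR_scale1 SR_scaleDr SR_scaleDl.

Lemma SR_scaleE (p : S) (a : SR_ring) : p *: a = SR_pi p * a.
Proof. by []. Qed.

End StanleyReisner.
Arguments SR_ideal K {n} D _.
Arguments SR_ring K {n} D.

Section CotangentCohomology.
Context (K : fieldType) {n : nat} (D : complex n).
Local Notation S := {mpoly K[n]}.
Local Notation A := (SR_ring K D).

(* The minimal monomial generators of I are the monomials of the minimal      *)
(* nonfaces, see SR_mingenP.                                                  *)
Definition min_nonfaces : {set {set 'I_n}} :=
  [set F | minset (fun G : {set 'I_n} => G \notin faces D) F]%SET.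

Definition ngens : nat := #|min_nonfaces|.

Definition gen (i : 'I_ngens) : S := xmon K (enum_val i).

Lemma SR_mingenP (m : 'X_{1..n}) :
  ('X_[m] \in SR_ideal K D /\
   forall m' : 'X_{1..n}, (m' <= m)%MM -> 'X_[m'] \in SR_ideal K D -> m' = m)
  <-> exists i, 'X_[m] = gen i.
Proof.
have xmonX F : xmon K F = 'X_[[multinom (i \in F : nat) | i < n]] by exact: xmonE.
have supI (m0 : 'X_{1..n}) : 'X_[m0] \in SR_ideal K D ->
    [set i | m0 i != 0%N]%SET \notin faces D.
  by move=> /SR_ideal_msupp; apply; rewrite msuppX inE.
split=> [[mI mmin]|[i E]].
  have [F Fmin sF] :=
      minset_exists (P := fun G : {set 'I_n} => G \notin faces D) (supI _ mI).
  have FI : F \in min_nonfaces by rewrite inE.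
  exists (enum_rank_in FI F); rewrite /gen enum_rankK_in // xmonX.
  congr 'X_[_]; apply/esym/mmin; last first.
    by rewrite -xmonX xmon_ideal // (minsetp Fmin).
  apply/mnm_lepP => i; rewrite mnmE; case: (boolP (i \in F)) => // iF.
  by have := fintype.subsetP sF i iF; rewrite inE lt0n.
rewrite /gen in E; have := enum_valP i; rewrite inE => /minsetP[].
move: (enum_val i) E => F; rewrite xmonX => E FD Fmin.
have {E}-> : m = [multinom (j \in F : nat) | j < n].
  by apply/eqP; rewrite -mem_seq1 -(@msuppX n K) -E msuppX inE.
split=> [|m' /mnm_lepP le_m' /supI m'D]; first by rewrite -xmonX xmon_ideal.
have sF : [set j | m' j != 0%N]%SET = F.
  apply: Fmin => //; apply/fintype.subsetP => j; rewrite inE => m'j.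
  by have := le_m' j; rewrite mnmE; case: (j \in F) m'j; case: (m' j).
apply/mnmP => j; have := le_m' j; rewrite mnmE -sF inE.
by case: (m' j) => [|[]].
Qed.

Definition gen_map (f : 'rV[S]_ngens) : S := \sum_i f ord0 i * gen i.

Fact gen_map_linear : linear_for ( *%R ) gen_map.
Proof.
move=> a f g; rewrite /gen_map mulr_sumr -big_split /=.
by apply: eq_bigr => i _; rewrite !mxE mulrDl mulrA.
Qed.

HB.instance Definition _ :=
  GRing.isLinear.Build S 'rV[S]_ngens S ( *%R ) gen_map gen_map_linear.

Lemma gen_map_ideal f : gen_map f \in SR_ideal K D.
Proof.
apply: rpred_sum => i _; apply: idealMr; apply: xmon_ideal.
by have := enum_valP i; rewrite inE => /minsetp.
Qed.

Lemma gen_map_onto p : p \in SR_ideal K D -> exists f, gen_map f = p.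
Proof.
move=> /asboolP[k [a [g [Gg ->]]]].
suff /choice[f fE] i : exists f, gen_map f = g i.
  exists (\sum_i a i *: f i); rewrite linear_sum.
  by apply: eq_bigr => i _; rewrite linearZ /= fE.
have [F [FD ->]] := Gg i.
have [G Gmin /finset.setIidPr sGF] :=
  minset_exists (P := fun G : {set 'I_n} => G \notin faces D) FD.
have GI : G \in min_nonfaces by rewrite inE.
exists (xmon K (F :\: G) *: delta_mx ord0 (enum_rank_in GI G)).
rewrite linearZ /= /gen_map (bigD1 (enum_rank_in GI G)) //= big1 => [|j /negPf nj].
  rewrite mxE !eqxx mul1r addr0 /gen enum_rankK_in // mulrC.
  by rewrite /xmon [RHS](big_setID G) /= sGF.
by rewrite mxE nj andbF mul0r.
Qed.

Definition syz_pred : {pred 'rV[S]_ngens} := fun f => gen_map f == 0.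

Fact syz_pred_submod : submod_closed syz_pred.
Proof.
split=> [|a f g /eqP f0 /eqP g0]; apply/eqP; first exact: raddf0.
by rewrite gen_map_linear f0 g0 mulr0 addr0.
Qed.

HB.instance Definition _ :=
  GRing.isSubmodClosed.Build S 'rV[S]_ngens syz_pred syz_pred_submod.

Record syz := MkSyz { syz_val :> 'rV[S]_ngens; syzP : syz_val \in syz_pred }.

HB.instance Definition _ := [isSub for syz_val].
HB.instance Definition _ := [Choice of syz by <:].
HB.instance Definition _ := [SubChoice_isSubLmodule of syz by <:].
HB.instance Definition _ := GRing.Linear.copy syz_val (val : syz -> 'rV[S]_ngens).

Definition koszul_rel (f g : 'rV[S]_ngens) : 'rV[S]_ngens :=
  gen_map f *: g - gen_map g *: f.

Lemma koszul_rel_syz f g : koszul_rel f g \in syz_pred.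
Proof. by apply/eqP; rewrite raddfB /= !linearZ /= mulrC subrr. Qed.

(* Kosz(I), seen inside the type of syzygies. *)
Definition kosz : {pred syz} := fun s =>
  `[< spanned (fun h => exists f g, h = koszul_rel f g) (syz_val s) >].

Fact kosz_submod : submod_closed kosz.
Proof.
split=> [|a s t /asboolP sK /asboolP tK]; apply/asboolP.
  by rewrite raddf0; exact: spanned0.
by rewrite linearP; apply: spannedD tK; apply: spannedZ.
Qed.

HB.instance Definition _ := GRing.isSubmodClosed.Build S syz kosz kosz_submod.

(* Syz(I) / Kosz(I); it is an S/I-module by ideal_syz_kosz. *)
Definition syz_kosz := Quotient.quot kosz.

HB.instance Definition _ := GRing.Zmodule.on syz_kosz.

Definition syz_pi (s : syz) : syz_kosz := \pi_syz_kosz s.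

HB.instance Definition _ := GRing.Additive.copy syz_pi \pi_syz_kosz.

Lemma syz_piP s t : syz_pi s = syz_pi t <-> s - t \in kosz.
Proof.
by rewrite (Quotient.idealrBE kosz); split=> [E|/eqP//]; apply/eqP.
Qed.

Lemma syz_reprK q : syz_pi (repr q) = q.
Proof. exact: reprK. Qed.

Lemma ideal_syz_kosz p (s : syz) : p \in SR_ideal K D -> p *: s \in kosz.
Proof.
move=> /gen_map_onto[f <-]; apply/asboolP/spanned_gen; exists f, (syz_val s).
by rewrite /koszul_rel (eqP (syzP s)) scale0r subr0.
Qed.

Definition syz_kosz_scale (a : A) (q : syz_kosz) : syz_kosz :=
  syz_pi (repr a *: repr q).

Lemma syz_kosz_scaleE p s : syz_kosz_scale (SR_pi D p) (syz_pi s) = syz_pi (p *: s).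
Proof.
apply/syz_piP; set p' := repr _; set s' := repr _.
have -> : p' *: s' - p *: s = (p' - p) *: s' + p *: (s' - s).
  by rewrite scalerBl scalerBr addrA subrK.
apply: rpredD.
  by apply/ideal_syz_kosz/SR_piP; rewrite SR_reprK.
by apply/rpredZ/syz_piP; rewrite syz_reprK.
Qed.

Fact syz_kosz_scaleA a b q :
  syz_kosz_scale a (syz_kosz_scale b q) = syz_kosz_scale (a * b) q.
Proof.
rewrite -(SR_reprK a) -(SR_reprK b) -(syz_reprK q) -rmorphM.
by rewrite !syz_kosz_scaleE scalerA.
Qed.
Fact syz_kosz_scale1 : left_id 1 syz_kosz_scale.
Proof.
by move=> q; rewrite -(rmorph1 (SR_pi D)) -(syz_reprK q) syz_kosz_scaleE scale1r.
Qed.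
Fact syz_kosz_scaleDr : right_distributive syz_kosz_scale +%R.
Proof.
move=> a q r; rewrite -(SR_reprK a) -(syz_reprK q) -(syz_reprK r) -raddfD.
by rewrite !syz_kosz_scaleE scalerDr raddfD.
Qed.
Fact syz_kosz_scaleDl q : {morph syz_kosz_scale^~ q : a b / a + b}.
Proof.
move=> a b /=; rewrite -(SR_reprK a) -(SR_reprK b) -(syz_reprK q) -rmorphD.
by rewrite !syz_kosz_scaleE scalerDl raddfD.
Qed.

HB.instance Definition _ := GRing.Zmodule_isLmodule.Build A syz_kosz
  syz_kosz_scaleA syz_kosz_scale1 syz_kosz_scaleDr syz_kosz_scaleDl.

Lemma syz_pi_scale p s : SR_pi D p *: syz_pi s = syz_pi (p *: s).
Proof. exact: syz_kosz_scaleE. Qed.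

(* Restriction to Syz(I) and descent to Syz(I) / Kosz(I). The choice of       *)
(* representative is immaterial, see restrE.                                  *)
Definition restr_fun (phi : hom 'rV[S]_ngens A) (q : syz_kosz) : A^o :=
  phi (repr q).

Lemma hom_kosz (phi : hom 'rV[S]_ngens A) (s : syz) : s \in kosz -> phi s = 0.
Proof.
move=> /asboolP[k [a [g [Gg ->]]]]; rewrite linear_sum big1 // => i _.
have [f [h ->]] := Gg i.
rewrite linearZ raddfB /= !linearZ /= !SR_scaleE.
by rewrite !(SR_pi_ideal (gen_map_ideal _)) !mul0r addr0 mulr0.
Qed.

Lemma restr_funE phi s : restr_fun phi (syz_pi s) = phi s.
Proof.
have /(hom_kosz phi): repr (syz_pi s) - s \in kosz by apply/syz_piP/syz_reprK.
by rewrite !linearB => /eqP; rewrite subr_eq0 => /eqP.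
Qed.

Fact restr_linear phi : linear (restr_fun phi).
Proof.
move=> a q r; rewrite -(SR_reprK a) -(syz_reprK q) -(syz_reprK r).
by rewrite syz_pi_scale -raddfD !restr_funE raddfD /= !linearZ.
Qed.

Definition restr (phi : hom 'rV[S]_ngens A) : hom syz_kosz A^o :=
  mkHom (restr_linear phi).

Lemma restrE phi s : restr phi (syz_pi s) = phi s.
Proof. exact: restr_funE. Qed.

Definition restr_image : {pred hom syz_kosz A^o} := fun psi =>
  `[< exists phi, psi = restr phi >].

Fact restr_image_submod : submod_closed restr_image.
Proof.
split=> [|a f g /asboolP[phi ->] /asboolP[psi ->]]; apply/asboolP.
  by exists 0; apply: homP => q; rewrite hom0E -(syz_reprK q) restrE hom0E.
exists (repr a *: phi + psi); apply: homP => q.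
rewrite -(syz_reprK q) homDE homZE !restrE homDE homZE.
by rewrite SR_scaleE SR_reprK.
Qed.

HB.instance Definition _ :=
  GRing.isSubmodClosed.Build A (hom syz_kosz A^o) restr_image restr_image_submod.

Definition T2 := Quotient.quot restr_image.

HB.instance Definition _ := GRing.Zmodule.on T2.

Definition T2_pi (psi : hom syz_kosz A^o) : T2 := \pi_T2 psi.

HB.instance Definition _ := GRing.Additive.copy T2_pi \pi_T2.

Lemma T2_piP psi psi' : T2_pi psi = T2_pi psi' <-> psi - psi' \in restr_image.
Proof.
by rewrite (Quotient.idealrBE restr_image); split=> [E|/eqP//]; apply/eqP.
Qed.

Lemma T2_reprK x : T2_pi (repr x) = x.
Proof. exact: reprK. Qed.

Definition T2_scale (a : A) (x : T2) : T2 := T2_pi (a *: repr x).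

Lemma T2_scaleE a psi : T2_scale a (T2_pi psi) = T2_pi (a *: psi).
Proof. by apply/T2_piP; rewrite -scalerBr; apply/rpredZ/T2_piP/T2_reprK. Qed.

Fact T2_scaleA a b x : T2_scale a (T2_scale b x) = T2_scale (a * b) x.
Proof. by rewrite -(T2_reprK x) !T2_scaleE scalerA. Qed.
Fact T2_scale1 : left_id 1 T2_scale.
Proof. by move=> x; rewrite -(T2_reprK x) T2_scaleE scale1r. Qed.
Fact T2_scaleDr : right_distributive T2_scale +%R.
Proof.
move=> a x y; rewrite -(T2_reprK x) -(T2_reprK y) -raddfD !T2_scaleE.
by rewrite scalerDr raddfD.
Qed.
Fact T2_scaleDl x : {morph T2_scale^~ x : a b / a + b}.
Proof.
by move=> a b /=; rewrite -(T2_reprK x) !T2_scaleE scalerDl raddfD.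
Qed.

HB.instance Definition _ := GRing.Zmodule_isLmodule.Build A T2
  T2_scaleA T2_scale1 T2_scaleDr T2_scaleDl.

Lemma T2_eq0P : (forall x : T2, x = 0) <-> forall psi, exists phi, psi = restr phi.
Proof.
split=> [T20 psi|E x].
  have /T2_piP : T2_pi psi = T2_pi 0 by rewrite [LHS]T20 [RHS]T20.
  by rewrite subr0 => /asboolP.
rewrite -(T2_reprK x) -(raddf0 T2_pi).
by apply/T2_piP; rewrite subr0; apply/asboolP/E.
Qed.

End CotangentCohomology.
Arguments T2 K {n} D.
Arguments syz K {n} D.
Arguments syz_kosz K {n} D.

(* Main.v *)
(* Any two distinct circuits of a matroid of corank at most two have the same
   union E. So the complements P_i in E of the circuits F_i are pairwise
   disjoint, the generators are x^E / y_i with y_i = x^(P_i), and every syzygy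
   has the form sum_i g_i y_i e_i with sum_i g_i = 0. Fix an index 0 and let
   a_i be the value of a homomorphism psi on y_i e_i - y_0 e_0. The Koszul
   relation of F_i and F_j kills x^(F_i & F_j) (a_i - a_j) in S/I, that is,
   a_i - a_j lies in the ideal (y_i, y_j). Solving the congruences
   c = a_i mod y_i, the map e_i |-> (a_i - c) / y_i restricts to psi. *)

Require Import Defs.
From mathcomp Require Import all_boot all_order all_algebra.
From mathcomp Require Import boolp mpoly zify.
Import GRing.Theory.
Local Open Scope ring_scope.

Set Implicit Arguments.
Unset Strict Implicit.
Unset Printing Implicit Defensive.

(** * Circuits of a matroid and their unions *)

Lemma min_nonfacesP n (M : complex n) (C : {set 'I_n}) :
  reflect (C \notin faces M /\ forall x, x \in C -> C :\ x \in faces M)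
          (C \in min_nonfaces M).
Proof.
rewrite inE; apply: (iffP minsetP) => [[CM Cmin]|[CM Cx]]; split=> //.
  move=> x xC; apply/negPn/negP => /Cmin/(_ (subsetDl _ _))/setP/(_ x).
  by rewrite setD11 xC.
move=> B BM sBC; apply/eqP; rewrite eqEsubset sBC /=; apply/subsetP => x xC.
apply: contraNT BM => xB; apply: complex_down (Cx x xC) _.
by rewrite subsetD1 sBC.
Qed.

Lemma face_extend n (M : complex n) (U I : {set 'I_n}) :
  I \in faces M -> I \subset U ->
  exists2 J : {set 'I_n}, I \subset J &
    maxset (fun J : {set 'I_n} => (J \in faces M) && (J \subset U)) J.
Proof.
move=> IM sIU; pose Q (J : {set 'I_n}) := (J \in faces M) && (J \subset U).
have [|J Jmax sIJ] := @maxset_exists _ Q I; first by rewrite /Q IM.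
by exists J.
Qed.

(** An exchange from a larger [I] would enlarge [J] by an element of [I], hence of [U], against
    maximality. *)
Lemma card_face_max n (M : complex n) (U I J : {set 'I_n}) : matroid M ->
  maxset (fun J : {set 'I_n} => (J \in faces M) && (J \subset U)) J ->
  I \in faces M -> I \subset U -> (#|I| <= #|J|)%N.
Proof.
move=> mM /maxsetP[/andP[JM sJU] Jmax] IM sIU.
rewrite leqNgt; apply/negP => ltJI.
have [v [vI vJ vJM]] := mM _ _ IM JM ltJI.
have E : v |: J = J.
  apply: Jmax (subsetUr _ _).
  by rewrite vJM subUset sub1set (subsetP sIU _ vI).
by move: vJ; rewrite -E setU11.
Qed.

Lemma min_nonface_diff n (M : complex n) (C C' : {set 'I_n}) :
  C \in min_nonfaces M -> C' \in min_nonfaces M -> C != C' ->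
  exists2 x, x \in C & x \notin C'.
Proof.
rewrite !inE => /minsetP[CM _] /minsetP[_ C'min] neCC'.
have /subsetPn : ~~ (C \subset C').
  by apply: contra neCC' => /(C'min _ CM) ->.
by [].
Qed.

(** With [x] in [C] but not in [C'], extend [C :\ x] to a maximal face [J] of the union. It misses
    [x], or it would contain [C], and some [y] of [C'], or it would contain [C']; these two elements
    differ. *)
Lemma card_face_setU n (M : complex n) (C C' I : {set 'I_n}) : matroid M ->
  C \in min_nonfaces M -> C' \in min_nonfaces M -> C != C' ->
  I \in faces M -> I \subset C :|: C' -> (#|I| + 2 <= #|C :|: C'|)%N.
Proof.
move=> mM cC cC' neCC' IM sIU.
have [x xC xC'] := min_nonface_diff cC cC' neCC'.
have [CM Cx] := min_nonfacesP _ _ cC; have [C'M _] := min_nonfacesP _ _ cC'.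
have [|J sCJ Jmax] := @face_extend _ M (C :|: C') _ (Cx x xC).
  by apply: subset_trans (subsetDl _ _) (subsetUl _ _).
apply: leq_trans (leq_add (card_face_max mM Jmax IM sIU) (leqnn _)) _.
have /andP[JM sJU] := maxsetp Jmax.
have xJ : x \notin J.
  apply: contra CM => xJ; apply: complex_down JM _.
  by rewrite -(setD1K xC) subUset sub1set xJ.
have /subsetPn[y yC' yJ] : ~~ (C' \subset J).
  by apply: contra C'M; exact: complex_down JM.
have neyx : y != x by apply: contraNneq xC' => <-.
have : y |: (x |: J) \subset C :|: C'.
  by rewrite !subUset !sub1set !inE xC yC' orbT.
move=> /subset_leq_card; rewrite !cardsU1 !inE negb_or neyx yJ xJ.
by rewrite !add1n addn2.
Qed.

(* A basis containing [C'' :\ e] misses [e] as well as two elements of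
   [C :|: C'], which is too much when the corank is at most two. *)
Lemma min_nonface_sub_setU n (M : complex n) (C C' C'' : {set 'I_n}) :
  matroid M -> (corank M <= 2)%N ->
  C \in min_nonfaces M -> C' \in min_nonfaces M -> C != C' ->
  C'' \in min_nonfaces M -> C'' \subset C :|: C'.
Proof.
move=> mM r2 cC cC' neCC' cC''; apply/negPn/negP => /subsetPn[e eC'' eU].
have [C''M C''x] := min_nonfacesP _ _ cC''.
have [B sB Bmax] := face_extend (C''x e eC'') (subsetT _).
have BM : B \in faces M by have /andP[] := maxsetp Bmax.
have eB : e \notin B.
  apply: contra C''M => eB; apply: complex_down BM _.
  by rewrite -(setD1K eC'') subUset sub1set eB.
have rB : (rank M <= #|B|)%N.
  by apply/bigmax_leqP => I IM; apply: card_face_max mM Bmax IM (subsetT _).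
have := card_face_setU mM cC cC' neCC'
  (complex_down BM (subsetIl B _)) (subsetIr _ _).
(* The part of [B] outside the union, the union and [e] are disjoint. As [B] misses two elements of
   the union, [#|B| + 3 <= n]. *)
have : (#|B :\: (C :|: C')| + #|C :|: C'| + 1 <= n)%N.
  rewrite -[X in (_ <= X)%N]card_ord -cardsT addn1.
  rewrite -(setD1K (in_setT e)) cardsU1.
  rewrite setD11 ltnS -cardsUI (_ : _ :&: _ = set0) ?cards0 ?addn0.
    apply/subset_leq_card; rewrite subUset !subsetD1 !subsetT eU /= inE.
    by rewrite (negPf eB) andbF.
  by rewrite setDE -setIA [_ :&: (_ :|: _)]setIC setICr setI0.
have := cardsID (C :|: C') B; move: r2 rB; rewrite /corank leq_subLR.
lia.
Qed.

(** * Divisibility and congruences for squarefree monomials *)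

Section SquarefreeMonomials.
Context (K : fieldType) (n : nat).
Implicit Types (F P : {set 'I_n}) (m : 'X_{1..n}) (p q : {mpoly K[n]}).

Definition mnm_support m : {set 'I_n} := [set i | m i != 0%N].

Definition mnm_set F : 'X_{1..n} := [multinom (i \in F : nat) | i < n].

Lemma mnm_supportD m F : mnm_support (m + mnm_set F)%MM = mnm_support m :|: F.
Proof.
by apply/setP => i; rewrite !inE mnmDE mnmE addn_eq0 negb_and; case: (i \in F).
Qed.

Lemma mnm_set_le F m : F \subset mnm_support m -> (mnm_set F <= m)%MM.
Proof.
move=> /subsetP sF; apply/mnm_lepP => i; rewrite mnmE.
by case: (boolP (i \in F)) => // /sF; rewrite inE lt0n.
Qed.

Lemma xmonU F P : [disjoint F & P] -> xmon K (F :|: P) = xmon K F * xmon K P.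
Proof.
move=> dFP; rewrite /xmon -bigU //.
by apply: eq_bigl => i; rewrite !inE.
Qed.

Lemma xmon_neq0 F : xmon K F != 0.
Proof. by rewrite xmonE -msupp_eq0 msuppX. Qed.

Lemma mcoeffM_xmon p F m : (p * xmon K F)@_(m + mnm_set F) = p@_m.
Proof. by rewrite addmC xmonE mcoeffMX. Qed.

Lemma msuppM_xmon p F m : m \in msupp (p * xmon K F) -> F \subset mnm_support m.
Proof.
rewrite xmonE => /msuppM_le/allpairsP[[m1 m2] /= [_ + ->]].
by rewrite msuppX inE => /eqP->; rewrite -/(mnm_set F) mnm_supportD subsetUr.
Qed.

Lemma xmon_dvd p F : (forall m, m \in msupp p -> F \subset mnm_support m) ->
  exists q, p = q * xmon K F.
Proof.
move=> sF; exists (\sum_(m <- msupp p) p@_m *: 'X_[(m - mnm_set F)%MM]).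
rewrite mulr_suml {1}[p]mpolyE; apply: eq_big_seq => m /sF/mnm_set_le le_m.
by rewrite xmonE -scalerAl -mpolyXD submK.
Qed.

(* Monomial ideals generate a distributive lattice, so pairwise congruences
   can be solved simultaneously: here one monomial at a time. *)
Lemma xmon_crt (I : finType) (P : I -> {set 'I_n}) (a : I -> {mpoly K[n]}) :
  (forall i j m, m \in msupp (a i - a j) ->
     P i \subset mnm_support m \/ P j \subset mnm_support m) ->
  exists c, forall i, exists b, a i - c = b * xmon K (P i).
Proof.
move=> aP; pose r := undup (flatten [seq msupp (a i) | i : I]).
(* Only the indices whose [P i] is not contained in the support of [m] prescribe the coefficient of
   the solution at [m]. By [aP] they all agree, so any of them will do; 0 serves when there is
   none. *)
pose f m := if [pick i | ~~ (P i \subset mnm_support m)] is Some i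
            then (a i)@_m else 0.
have cE m : (\sum_(m' <- r) f m' *: 'X_[m'])@_m = f m.
  rewrite raddf_sum /=; case: (boolP (m \in r)) => mr.
    rewrite (bigD1_seq m) ?undup_uniq //= mcoeffZ mcoeffX eqxx mulr1.
    rewrite big1 ?addr0 // => m' /negPf ne; by rewrite mcoeffZ mcoeffX ne mulr0.
  (* [r] contains every monomial of every [a i], so [f m] is 0 outside [r]. *)
  rewrite big_seq big1 => [|m' m'r]; last first.
    by rewrite mcoeffZ mcoeffX; case: eqP m'r mr => [->->|]; rewrite ?mulr0.
  rewrite /f; case: pickP => // i _; apply/esym/memN_msupp_eq0.
  apply: contra mr => mi; rewrite mem_undup; apply/flatten_mapP.
  by exists i; rewrite ?mem_enum.
exists (\sum_(m' <- r) f m' *: 'X_[m']) => i; apply: xmon_dvd => m.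
rewrite mcoeff_msupp mcoeffB cE; apply: contraNT => nPi.
rewrite /f; case: pickP => [j nPj|/(_ i)]; last by rewrite nPi.
rewrite -mcoeffB mcoeff_eq0; apply/negP => /aP[]; exact/negP.
Qed.

End SquarefreeMonomials.

(** * Syzygies and [T2] when any two minimal nonfaces cover all of them *)

Section CoveringCircuits.
Context (K : fieldType) (n : nat) (D : complex n).
Context (setU_cover : forall C C' : {set 'I_n},
  C \in min_nonfaces D -> C' \in min_nonfaces D -> C != C' ->
  C :|: C' = cover (min_nonfaces D)).

Local Notation N := (ngens D).
Local Notation E := (cover (min_nonfaces D)).
Local Notation e i := (delta_mx ord0 i : 'rV[{mpoly K[n]}]_N).
Let F (i : 'I_N) : {set 'I_n} := enum_val i.
Let P (i : 'I_N) : {set 'I_n} := E :\: F i.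
Let y i := xmon K (P i).

Let F_cover i : F i \subset E.
Proof. exact: bigcup_sup (enum_valP i). Qed.

Let F_setU i j : i != j -> F i :|: F j = E.
Proof.
move=> ij; apply: setU_cover (enum_valP _) (enum_valP _) _.
by rewrite (inj_eq enum_val_inj).
Qed.

Let P_sub i (C : {set 'I_n}) :
  C \in min_nonfaces D -> C != F i -> P i \subset C.
Proof.
by move=> CD CF; rewrite subDset setUC setU_cover // enum_valP.
Qed.

Let P_disjoint i : [disjoint P i & F i].
Proof. by rewrite disjoints_subset subsetDr. Qed.

Let P_subU i (U : {set 'I_n}) : P i \subset U :|: F i -> P i \subset U.
Proof.
by rewrite setUC -subDset setDDl setUid.
Qed.

Let genP i : gen K i * y i = xmon K E.
Proof.
rewrite mulrC -xmonU ?P_disjoint // setUC /P setDE setUIr setUCr setIT.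
by rewrite (setUidPr (F_cover i)).
Qed.

(** As [F i] and [F j] cover [E], the complement [P j] is [F i :\: F j]. *)
Let genI i j : i != j -> gen K i = xmon K (F i :&: F j) * y j.
Proof.
move=> ij; rewrite -xmonU.
  by rewrite /P -(F_setU ij) setDUl setDv setU0 setID.
rewrite disjoint_sym disjoints_subset setCI subsetU //.
by rewrite [X in _ || X]subsetDr orbT.
Qed.

Lemma gen_map_delta i : gen_map (e i) = gen K i.
Proof.
rewrite /gen_map (bigD1 i) //= mxE !eqxx mul1r big1 ?addr0 // => j /negPf ji.
by rewrite mxE ji andbF mul0r.
Qed.

(* [P i] lies in every other circuit and is disjoint from [F i], so [y i]
   divides the [i]-th coordinate. *)
Lemma syz_factor (f : 'rV[{mpoly K[n]}]_N) : gen_map f = 0 ->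
  exists2 g : 'I_N -> {mpoly K[n]},
    forall i, f ord0 i = g i * y i & \sum_i g i = 0.
Proof.
move=> f0; have /choice[g gE] i : exists q, f ord0 i = q * y i.
  apply: xmon_dvd => m; rewrite mcoeff_msupp => fm.
  apply: P_subU; rewrite -mnm_supportD.
  move: f0; rewrite /gen_map (bigD1 i) //= => /eqP; rewrite addr_eq0 => /eqP f0.
  move: fm; rewrite -(mcoeffM_xmon _ (F i)) f0 mcoeffN oppr_eq0 raddf_sum /=.
  apply: contraR => nP; rewrite big1 ?eqxx // => j ji.
  apply/eqP; rewrite mcoeff_eq0; apply: contra nP => /msuppM_xmon.
  by apply: subset_trans; rewrite P_sub ?enum_valP ?(inj_eq enum_val_inj).
(* Each term of the syzygy equation is [g i * xmon K E], and the common factor cancels. *)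
exists g => //; apply: (mulIf (xmon_neq0 K E)); rewrite mul0r -[RHS]f0.
rewrite mulr_suml; apply: eq_bigr => i _.
by rewrite gE -mulrA [y i * _]mulrC genP.
Qed.

Let t_val i j : 'rV[{mpoly K[n]}]_N := y i *: e i - y j *: e j.

Let t_syz i j : t_val i j \in @syz_pred K n D.
Proof.
apply/eqP; rewrite raddfB /= !linearZ /= !gen_map_delta.
by rewrite ![y _ * _]mulrC !genP subrr.
Qed.

Let t i j : syz K D := MkSyz (t_syz i j).

(** The terms at [i0] cancel, and by [genI] what remains is the Koszul relation of the generators
    [j] and [i]. *)
Let t_kosz i0 i j : i != j ->
  xmon K (F i :&: F j) *: (t i i0 - t j i0) \in @kosz K n D.
Proof.
move=> ij; apply/asboolP/spanned_gen; exists (e j), (e i).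
rewrite linearZ raddfB /= /t_val -scalerBr opprB addrA subrK scalerBr !scalerA.
by rewrite /koszul_rel !gen_map_delta -genI // setIC -genI 1?eq_sym.
Qed.

Lemma T2_eq0_of_setU_cover (x : T2 K D) : x = 0.
Proof.
move: x; apply/T2_eq0P => psi.
case: (pickP (@predT 'I_N)) => [i0 _|N0]; last first.
  (* Without generators every syzygy is the empty row. *)
  exists 0; apply: homP => q; rewrite -(syz_reprK q) restrE.
  suff -> : repr q = 0 by rewrite !raddf0.
  by apply/val_inj/rowP => i; have := N0 i.
have [a aE] : exists a, forall i, SR_pi D (a i) = psi (syz_pi (t i i0)).
  by exists (fun i => repr (psi (syz_pi (t i i0)))) => i; rewrite SR_reprK.
have [|c /choice[b bE]] := @xmon_crt K n _ P a.
  move=> i j m am; have [ij|ij] := eqVneq i j.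
    by move: am; rewrite ij subrr msupp0.
  have : (a i - a j) * xmon K (F i :&: F j) \in SR_ideal K D.
    rewrite -[X in X \in _]subr0; apply/SR_piP.
    rewrite rmorphM rmorphB /= !aE rmorph0 mulrC.
    have : psi (SR_pi D (xmon K (F i :&: F j)) *: syz_pi (t i i0 - t j i0)) = 0.
      rewrite syz_pi_scale -[RHS](raddf0 psi); congr (psi _).
      rewrite -[RHS](raddf0 (@syz_pi K n D)).
      by apply/syz_piP; rewrite subr0 t_kosz.
    by rewrite linearZ (raddfB (@syz_pi K n D)) (raddfB psi).
  move=> /(@SR_ideal_msupp _ _ _ _ (m + mnm_set (F i :&: F j))%MM).
  rewrite mcoeff_msupp mcoeffM_xmon -mcoeff_msupp => /(_ am).
  rewrite -/(mnm_support _) mnm_supportD.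
  move=> /(@minset_exists _ (fun G => G \notin faces D))[C Cmin sC].
  have CD : C \in min_nonfaces D by rewrite inE.
  (* A circuit [C] other than [F k] contains [P k], which is disjoint from [F k] and so comes from
     the support of [m]. As [C] cannot equal both [F i] and [F j], one of the two choices of [k]
     applies. *)
  have sP k : F i :&: F j \subset F k -> C != F k -> P k \subset mnm_support m.
    move=> sF CF; apply: P_subU; apply: subset_trans (P_sub CD CF) _.
    exact: subset_trans sC (setUS _ sF).
  have [CF|] := eqVneq C (F i); last by left; apply: sP (subsetIl _ _) _.
  right; apply: sP (subsetIr _ _) _.
  by rewrite CF (inj_eq enum_val_inj).
(* Here [e i] goes to the class of [b i], so [y i *: e i] goes to that of [a i - c]. *)
pose phi (f : 'rV[{mpoly K[n]}]_N) := SR_pi D (\sum_i f ord0 i * b i).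
have phi_linear : linear phi.
  move=> p f h; rewrite SR_scaleE -rmorphM -rmorphD mulr_sumr -big_split /=.
  congr (SR_pi D _); apply: eq_bigr => i _.
  by rewrite !mxE mulrDl mulrA.
exists (mkHom phi_linear); apply: homP => q; rewrite -(syz_reprK q) restrE /=.
move: (repr q) => s; have [g sE g0] := syz_factor (eqP (syzP s)).
have sS : s = \sum_i g i *: t i i0.
  apply: val_inj; rewrite [RHS](linear_sum (@syz_val K n D)) /=.
  have -> : \sum_i syz_val (g i *: t i i0) =
      \sum_i (g i *: (y i *: e i) - g i *: (y i0 *: e i0)).
    by apply: eq_bigr => i _; rewrite -scalerBr.
  rewrite sumrB -scaler_suml g0 scale0r subr0.
  apply/rowP => i; rewrite summxE (bigD1 i) //= !mxE !eqxx mulr1 sE.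
  rewrite big1 ?addr0 // => j /negPf ji.
  by rewrite !mxE [i == j]eq_sym ji andbF !mulr0.
rewrite [in LHS]sS !(raddf_sum (@syz_pi K n D)) (raddf_sum psi) /phi.
transitivity (SR_pi D (\sum_i g i * a i)).
  rewrite rmorph_sum; apply: eq_bigr => i _.
  by rewrite rmorphM /= aE -syz_pi_scale linearZ.
(* The shift by [c] is free because [g] sums to 0, and it turns each term into [g i * b i * y i]. *)
have -> : \sum_i g i * a i = \sum_i g i * (a i - c).
  under [RHS]eq_bigr do rewrite mulrBr.
  by rewrite sumrB -mulr_suml g0 mul0r subr0.
congr (SR_pi D _); apply: eq_bigr => i _.
by rewrite sE bE mulrAC mulrA.
Qed.

End CoveringCircuits.

Theorem proposition5p1 (K : fieldType) (n : nat) (M : complex n)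
  (M_matroid : matroid M) (M_corank : (corank M <= 2)%N) :
  forall x : T2 K M, x = 0.
Proof.
apply: T2_eq0_of_setU_cover => C C' cC cC' neCC'; apply/eqP.
rewrite eqEsubset subUset (bigcup_sup C) // (bigcup_sup C') //=.
apply/bigcupsP => C'' cC''.
exact: min_nonface_sub_setU M_matroid M_corank cC cC' neCC' cC''.
Qed.
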